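(* For any integer $m\ge 2$ and $\varepsilon=\pm 1$, the affine polar graph $\mathrm{VO}_{2m}^{\varepsilon}(2)$ is triply-transitive.
   Context: The affine polar graph $\mathrm{VO}^{\varepsilon}_{2m}(2)$: on $V=\mathbb{F}_2^{2m}$ let $Q(\boldsymbol{x})=x_1x_2+\cdots+x_{2m-3}x_{2m-2}+f(x_{2m-1},x_{2m})$, where $f(x_{2m-1},x_{2m})=x_{2m-1}x_{2m}$ if $\varepsilon=1$ and $f(x_{2m-1},x_{2m})=x_{2m-1}^2+x_{2m-1}x_{2m}+x_{2m}^2$ if $\varepsilon=-1$. The vertex set is $V$, and two distinct vectors $\boldsymbol{u},\boldsymbol{v}$ are adjacent iff $Q(\boldsymbol{u}-\boldsymbol{v})=0$. A graph $\Gamma=(\Omega,E)$ is strongly regular with parameters $(v,k,\lambda,\mu)$ if it has $v$ vertices, is $k$-regular, every pair of adjacent vertices has exactly $\lambda$ common neighbours, and every pair of distinct non-adjacent vertices has exactly $\mu$ common neighbours. Triply-transitive. Let $\Gamma=(\Omega,E)$ be strongly regular. Let $A_0=I$, let $A_1$ be the adjacency matrix of $\Gamma$ and $A_2$ the adjacency matrix of its complement. For $\omega\in\Omega$ let $\Delta_0(\omega)=\{\omega\}$, let $\Delta_1(\omega)$ be the set of neighbours of $\omega$, and let $\Delta_2(\omega)$ be the set of vertices different from and not adjacent to $\omega$. For $i=0,1,2$ let $E^*_{i,\omega}$ be the diagonal $0/1$ matrix (indexed by $\Omega$) with $(\alpha,\alpha)$-entry $1$ iff $\alpha\in\Delta_i(\omega)$.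 Define - $T_{0,\omega}=\operatorname{Span}_{\mathbb{C}}\{E^*_{i,\omega}A_jE^*_{k,\omega}: i,j,k\in\{0,1,2\}\}$; - $T_\omega$, the Terwilliger algebra: the subalgebra of $\mathrm{Mat}_{|\Omega|}(\mathbb{C})$ generated by $A_0,A_1,A_2,E^*_{0,\omega},E^*_{1,\omega},E^*_{2,\omega}$; - $\widetilde{T}_\omega=\{X\in \mathrm{Mat}_{|\Omega|}(\mathbb{C}): P_gX=XP_g \text{ for all } g\in \mathrm{Aut}(\Gamma)_\omega\}$, where $\mathrm{Aut}(\Gamma)_\omega$ is the stabilizer of $\omega$ in the full automorphism group of $\Gamma$ and $P_g$ is the permutation matrix of $g$. Then $T_{0,\omega}\subseteq T_\omega\subseteq\widetilde{T}_\omega$. The graph $\Gamma$ is triply-transitive if it is vertex-transitive and $T_{0,\omega}=T_\omega=\widetilde{T}_\omega$ for any vertex $\omega$. *)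

(* Defs.v *)
From HB Require Import structures.
From mathcomp Require Import all_boot all_order all_fingroup all_algebra.
From mathcomp Require Import all_classical reals.
From mathcomp Require Import complex.

Set Implicit Arguments.
Unset Strict Implicit.
Unset Printing Implicit Defensive.

Import Order.TTheory GRing.Theory Num.Theory.
Local Open Scope ring_scope.

Section Graphs.
Variables (T : finType) (e : rel T).

Definition simple_graph : Prop := symmetric e /\ irreflexive e.

Definition common_neighbours (x y : T) : {set T} := [set z | e x z && e y z]%SET.

Definition strongly_regular (v k lambda mu : nat) : Prop :=
  [/\ simple_graph,
      #|T| = v,
      forall x, #|[set y | e x y]%SET| = k,
      forall x y, e x y -> #|common_neighbours x y| = lambda
    & forall x y, x != y -> ~~ e x y -> #|common_neighbours x y| = mu].

Definition is_automorphism (g : {perm T}) : Prop :=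
  forall x y, e (g x) (g y) = e x y.

Definition vertex_transitive : Prop :=
  forall x y, exists2 g : {perm T}, is_automorphism g & g x = y.

Definition Delta (i : 'I_3) (w : T) : {set T} :=
  match val i with
  | 0%N => [set w]%SET
  | 1%N => [set y | e w y]%SET
  | _ => [set y | (y != w) && ~~ e w y]%SET
  end.

End Graphs.

(* A matrix indexed by [T] is an element of ['M_#|T|], row and column [i]
   standing for the vertex [enum_val i]. *)

Section Terwilliger.
Variables (C : fieldType) (T : finType) (e : rel T).

Local Notation Mat := ('M[C]_#|T|).

Definition rel_mx (r : rel T) : Mat :=
  \matrix_(i, j) (r (enum_val i) (enum_val j))%:R.

Definition adj_mx (i : 'I_3) : Mat :=
  match val i with
  | 0%N => 1%:M
  | 1%N => rel_mx e
  | _ => rel_mx (fun x y => (x != y) && ~~ e x y)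
  end.

Definition dual_idem (w : T) (i : 'I_3) : Mat :=
  rel_mx (fun x y => (x == y) && (x \in Delta e i w)).

Definition vertex_perm_mx (g : {perm T}) : Mat :=
  rel_mx (fun x y => g x == y).

Definition T0_space (w : T) : {vspace Mat} :=
  <<[seq dual_idem w p.1.1 *m adj_mx p.1.2 *m dual_idem w p.2
       | p : 'I_3 * 'I_3 * 'I_3]>>%VS.

(* When [T] is empty, [Mat] is the zero ring, so it carries no MathComp algebra
   structure for a general [T]; subalgebras are therefore described as sets. *)
Definition is_subalgebra (B : set Mat) : Prop :=
  [/\ B 1%:M,
      forall (a : C) X Y, B X -> B Y -> B (a *: X + Y)
    & forall X Y, B X -> B Y -> B (X *m Y)].

Definition terwilliger_algebra (w : T) : set Mat :=
  smallest is_subalgebra (range adj_mx `|` range (dual_idem w))%classic.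

Definition stab_centralizer (w : T) : set Mat :=
  [set X : Mat | forall g : {perm T}, is_automorphism e g -> g w = w ->
     vertex_perm_mx g *m X = X *m vertex_perm_mx g]%classic.

End Terwilliger.

Arguments adj_mx C {T} e i.
Arguments dual_idem C {T} e w i.
Arguments vertex_perm_mx C {T} g.
Arguments T0_space C {T} e w.
Arguments terwilliger_algebra C {T} e w _.
Arguments stab_centralizer C {T} e w _.

(* The choice of [R] is immaterial: every [realType] is a copy of the real
   numbers, so that [R[i]] is the field of complex numbers. *)
Definition triply_transitive (R : realType) (T : finType) (e : rel T) : Prop :=
  [/\ exists v k lambda mu, strongly_regular e v k lambda mu,
      vertex_transitive e
    & forall w : T,
        [set` T0_space R[i] e w]%classic = terwilliger_algebra R[i] e w
        /\ terwilliger_algebra R[i] e w = stab_centralizer R[i] e w].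

(* The coordinate x_(k+1) of [x]; the value 0 for [n <= k] is a dummy. *)
Definition entry n (x : 'rV['F_2]_n) (k : nat) : 'F_2 :=
  if insub k is Some i then x 0 i else 0.

Definition polar_tail (eps : int) (s t : 'F_2) : 'F_2 :=
  if eps == 1 then s * t else s ^+ 2 + s * t + t ^+ 2.

Definition polar_form (m : nat) (eps : int) (x : 'rV['F_2]_(2 * m)) : 'F_2 :=
  \sum_(i < m.-1) entry x (2 * i) * entry x (2 * i).+1
  + polar_tail eps (entry x (2 * m.-1)) (entry x (2 * m.-1).+1).

(* Intended for [0 < m] and [eps] equal to [1] or [-1]. *)
Definition VO (m : nat) (eps : int) : rel 'rV['F_2]_(2 * m) :=
  fun u v => (u != v) && (polar_form eps (u - v) == 0).

(* Main.v *)
Require Import Defs.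
From mathcomp Require Import all_boot all_order all_algebra.
From mathcomp Require Import reals.
From mathcomp Require Import all_fingroup all_classical complex.

(** For a quadratic form Q with nondegenerate polarization B over F_2, the
    graph joining distinct u and v when Q (u - v) = 0 admits the affine
    isometries of Q as automorphisms. Translations give vertex-transitivity,
    so everything is about the stabilizer of one vertex, which contains the
    linear isometries.

    The spaces T_0 and the centralizer of the stabilizer are both spaces of
    matrices constant on the parts of a partition of the pairs (x, y): for T_0
    the parts record the relations between w and x, x and y, w and y; for the
    centralizer they are the orbits of the stabilizer of w. As
    T_0 <= T <= centralizer always holds, it suffices that the three relations
    determine the orbit ([centralizer_sub_T0]). The same transitivity makes
    the automorphism group transitive on each of the three relations, hence
    the graph strongly regular.

    For w = 0 the three relations amount to the values Q x, Q y, Q (x + y)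
    and to which of x, y, x + y vanish, so what is needed is the theorem of
    Witt for subspaces of dimension at most 2 ([isometry_pair]). It is
    obtained by moving one vector at a time ([isometry_extension]): to send y
    to y' while fixing x, put a = y + y'. If Q a = 1 the transvection along a
    does it. If Q a = 0 then x, y and y' are all orthogonal to a, and a Siegel
    transformation attached to a does it. *)

Import GRing.Theory Num.Theory.
Local Open Scope ring_scope.

Set Implicit Arguments.
Unset Strict Implicit.
Unset Printing Implicit Defensive.

(** * Graphs and their Terwilliger algebras *)

Section RelationIndex.
Variables (T : finType) (e : rel T).

Definition rel_index (x y : T) : 'I_3 :=
  if x == y then inord 0 else if e x y then inord 1 else inord 2.

Lemma rel_indexxx x : rel_index x x = inord 0.
Proof. by rewrite /rel_index eqxx. Qed.

Lemma val_rel_index x y :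
  rel_index x y = (if x == y then 0 else if e x y then 1 else 2)%N :> nat.
Proof. by rewrite /rel_index; do 2?case: ifP => _; rewrite inordK. Qed.

Lemma rel_index_inj x y x' y' : irreflexive e ->
  rel_index x y = rel_index x' y' -> (x == y) = (x' == y') /\ e x y = e x' y'.
Proof.
move=> eI /(congr1 val); rewrite /= !val_rel_index.
case: eqP => [<-|_]; case: eqP => [<-|_]; rewrite ?eI //;
  by do 2?case: ifP.
Qed.

Lemma in_Delta (i : 'I_3) w x : irreflexive e ->
  (x \in Delta e i w) = (rel_index w x == i).
Proof.
move=> eI; rewrite /Delta -val_eqE /= val_rel_index.
case: i => [[|[|[|//]]] lti] /=; rewrite !inE ?[x == w]eq_sym;
  by case: (w =P x) => [wx|_]; rewrite -?wx ?eI //=; case: ifP.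
Qed.

Lemma rel_index_aut (g : {perm T}) x y : is_automorphism e g ->
  rel_index (g x) (g y) = rel_index x y.
Proof. by move=> eg; rewrite /rel_index eg (inj_eq perm_inj). Qed.

Lemma card_common_neighbours_aut (g : {perm T}) x y : is_automorphism e g ->
  #|common_neighbours e (g x) (g y)| = #|common_neighbours e x y|.
Proof.
move=> eg; rewrite -(card_imset (mem (common_neighbours e x y)) (@perm_inj _ g)).
apply: eq_card => z; rewrite -[z](permKV g) mem_imset; last exact: perm_inj.
by rewrite !inE !eg.
Qed.

(** The automorphisms fixing w are as transitive on pairs as the relations
    between three vertices permit. *)
Definition stabilizer_transitive : Prop :=
  forall w x y x' y', rel_index w x = rel_index w x' ->
    rel_index w y = rel_index w y' -> rel_index x y = rel_index x' y' ->
    exists g : {perm T}, [/\ is_automorphism e g, g w = w, g x = x' & g y = y'].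

(** Automorphisms are transitive on the pairs in a given relation: move x to
    x0, then use the stabilizer of x0. For the relation of equality the count
    is the valency, since the common neighbours of x and x are the neighbours
    of x. *)
Lemma card_common_neighbours_const :
  vertex_transitive e -> stabilizer_transitive ->
  forall i, exists n, forall x y, rel_index x y = i ->
    #|common_neighbours e x y| = n.
Proof.
move=> vt st i.
have [[x0 y0] /eqP i0|none] := pickP [pred p : T * T | rel_index p.1 p.2 == i].
  exists #|common_neighbours e x0 y0| => x y ixy.
  have [g eg gx] := vt x x0.
  have [|||h [eh hx _ hy]] := st x0 x0 (g y) x0 y0 => //.
  - by rewrite -gx rel_index_aut // ixy -i0 gx.
  - by rewrite -gx rel_index_aut // ixy -i0 gx.
  by rewrite -hx -hy -gx !card_common_neighbours_aut.
by exists 0%N => x y ixy; have := none (x, y); rewrite /= ixy eqxx.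
Qed.

Lemma strongly_regular_of_transitive :
  simple_graph e -> vertex_transitive e -> stabilizer_transitive ->
  exists v k lambda mu, strongly_regular e v k lambda mu.
Proof.
move=> se vt st; have eI := se.2.
have nP := card_common_neighbours_const vt st.
have [k kP] := nP (inord 0); have [l lP] := nP (inord 1).
have [mu muP] := nP (inord 2).
exists #|T|, k, l, mu; split=> // [x|x y exy|x y nxy nexy].
- rewrite -(kP x x) ?rel_indexxx //; apply: eq_card => z.
  by rewrite !inE andbb.
- by apply: lP; rewrite /rel_index exy; case: eqP exy => // ->; rewrite eI.
- by apply: muP; rewrite /rel_index (negPf nxy) (negPf nexy).
Qed.

End RelationIndex.

Section Matrices.
Variables (C : fieldType) (T : finType) (e : rel T).
Local Notation Mat := ('M[C]_#|T|).
Local Notation rel_mx := (@rel_mx C T).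

Lemma sum_pick (F : 'I_#|T| -> C) (x : T) :
  \sum_i (x == enum_val i)%:R * F i = F (enum_rank x).
Proof.
rewrite (bigD1 (enum_rank x)) //= enum_rankK eqxx mul1r big1 ?addr0 // => i ni.
by case: (x =P enum_val i) ni => [->|_]; rewrite ?enum_valK ?eqxx ?mul0r.
Qed.

Lemma eq_rel_mx (r s : rel T) : r =2 s -> rel_mx r = rel_mx s.
Proof. by move=> rs; apply/matrixP => i j; rewrite !mxE rs. Qed.

Lemma mul_vertex_perm_mx (g : {perm T}) (X : Mat) i j :
  (vertex_perm_mx C g *m X) i j = X (enum_rank (g (enum_val i))) j.
Proof.
by rewrite mxE -(sum_pick (X^~ j)); apply: eq_bigr => k _; rewrite mxE.
Qed.

Lemma mulmx_vertex_perm (g : {perm T}) (X : Mat) i j :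
  (X *m vertex_perm_mx C g) i (enum_rank (g (enum_val j))) = X i j.
Proof.
rewrite mxE -[in RHS](enum_valK j) -(sum_pick (X i)).
apply: eq_bigr => k _; rewrite mxE enum_rankK (inj_eq perm_inj) mulrC.
by rewrite eq_sym.
Qed.

(** Commuting with a permutation matrix means being constant on its orbits
    on pairs. *)
Lemma vertex_perm_commP (g : {perm T}) (X : Mat) :
  vertex_perm_mx C g *m X = X *m vertex_perm_mx C g <->
  forall x y, X (enum_rank (g x)) (enum_rank (g y))
              = X (enum_rank x) (enum_rank y).
Proof.
split=> [eqX x y|invX].
  by rewrite -[RHS](mulmx_vertex_perm g) -eqX mul_vertex_perm_mx !enum_rankK.
apply/matrixP => i j; rewrite mul_vertex_perm_mx.
have [k ->] : exists k : 'I_#|T|, j = enum_rank (g (enum_val k)).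
  by exists (enum_rank ((g^-1)%g (enum_val j))); rewrite enum_rankK permKV enum_valK.
by rewrite mulmx_vertex_perm invX !enum_valK.
Qed.

Lemma rel_mx_comm (g : {perm T}) (r : rel T) :
  (forall x y, r (g x) (g y) = r x y) ->
  vertex_perm_mx C g *m rel_mx r = rel_mx r *m vertex_perm_mx C g.
Proof. by move=> rg; apply/vertex_perm_commP=> x y; rewrite !mxE !enum_rankK rg. Qed.

Lemma adj_mxE (i : 'I_3) : irreflexive e ->
  adj_mx C e i = rel_mx (fun x y => rel_index e x y == i).
Proof.
move=> eI; apply/matrixP => a b.
rewrite [RHS]mxE -val_eqE /= val_rel_index /adj_mx.
case: i => [[|[|[|//]]] lti] /=; rewrite mxE ?(inj_eq enum_val_inj);
  by case: (a =P b) => [ab|_]; rewrite ?ab ?eI //; case: ifP.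
Qed.

Lemma dual_idemE w (i : 'I_3) : irreflexive e ->
  dual_idem C e w i = rel_mx (fun x y => (x == y) && (rel_index e w x == i)).
Proof. by move=> eI; apply: eq_rel_mx => x y; rewrite in_Delta. Qed.

Lemma diag_rel_mx_mul (p : pred T) (r : rel T) :
  rel_mx (fun x y => (x == y) && p x) *m rel_mx r = rel_mx (fun x y => p x && r x y).
Proof.
apply/matrixP => i j; rewrite !mxE.
rewrite -(enum_valK i) -(sum_pick (fun k => (p (enum_val k) && r (enum_val k) (enum_val j))%:R)).
apply: eq_bigr => k _; rewrite !mxE enum_rankK.
by case: eqP => [->|_]; rewrite ?mul0r // mul1r -natrM mulnb.
Qed.

Lemma rel_mx_mul_diag (p : pred T) (r : rel T) :
  rel_mx r *m rel_mx (fun x y => (x == y) && p x) = rel_mx (fun x y => r x y && p y).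
Proof.
apply/matrixP => i j; rewrite !mxE.
rewrite -(enum_valK j) -(sum_pick (fun k => (r (enum_val i) (enum_val k) && p (enum_val k))%:R)).
apply: eq_bigr => k _; rewrite !mxE enum_rankK [_ k == _]eq_sym.
by case: eqP; rewrite ?mul0r ?mulr0 // mul1r -natrM mulnb.
Qed.

Lemma T0_generatorE w (i j k : 'I_3) : irreflexive e ->
  dual_idem C e w i *m adj_mx C e j *m dual_idem C e w k =
  rel_mx (fun x y => [&& rel_index e w x == i, rel_index e x y == j
                       & rel_index e w y == k]).
Proof.
move=> eI; rewrite !dual_idemE // adj_mxE // diag_rel_mx_mul rel_mx_mul_diag.
by apply: eq_rel_mx => x y; rewrite andbA.
Qed.

Lemma is_subalgebra_span (B : set Mat) (s : seq Mat) :
  is_subalgebra B -> (forall X, X \in s -> B X) ->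
  forall X, X \in <<s>>%VS -> B X.
Proof.
case=> B1 BD _ sB X Xs.
have B0 : B 0 by have := BD (-1) _ _ B1 B1; rewrite scaleN1r addNr.
rewrite (coord_span (X := in_tuple s) Xs).
apply: (big_rec B) => // i Y _ BY; apply: BD => //.
by apply/sB/mem_nth/ltn_ord.
Qed.

(** A generator of T_0 is a product of generators of the algebra T. *)
Lemma T0_sub_terwilliger w X : X \in T0_space C e w -> terwilliger_algebra C e w X.
Proof.
move=> XT0 B [[B1 BD BM] gB]; apply: is_subalgebra_span XT0 => // Y.
case/mapP=> [[[i j] k] _ ->] /=.
by apply: (BM); [apply: (BM)|]; apply: gB; [right; exists i|left; exists j|right; exists k].
Qed.

(** Automorphisms fixing w preserve each relation and each relation to w, so
    the generators of T lie in the centralizer, which is an algebra. *)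
Lemma terwilliger_sub_centralizer w X : irreflexive e ->
  terwilliger_algebra C e w X -> stab_centralizer C e w X.
Proof.
move=> eI; apply; split.
  split=> [g _ _|a Y Z YC ZC g eg gw|Y Z YC ZC g eg gw].
  - by rewrite mulmx1 mul1mx.
  - by rewrite mulmxDr mulmxDl -scalemxAr -scalemxAl YC // ZC.
  - by rewrite mulmxA YC // -mulmxA ZC // mulmxA.
move=> Y [[i _ <-]|[i _ <-]] g eg gw.
  by rewrite adj_mxE //; apply: rel_mx_comm => x y; rewrite rel_index_aut.
rewrite dual_idemE //; apply: rel_mx_comm => x y.
by rewrite (inj_eq perm_inj) -[in LHS]gw rel_index_aut.
Qed.

(** A matrix of the centralizer has a single value on each triple of
    relations, so it is the combination of the generators of T_0 with these
    values as coefficients. *)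
Lemma centralizer_sub_T0 w X : irreflexive e -> stabilizer_transitive e ->
  stab_centralizer C e w X -> X \in T0_space C e w.
Proof.
move=> eI st XC.
pose cls x y := (rel_index e w x, rel_index e x y, rel_index e w y).
(* The value 0 is a dummy for triples of relations realised by no (x, y). *)
pose coef t := if [pick p : T * T | cls p.1 p.2 == t] is Some p
               then X (enum_rank p.1) (enum_rank p.2) else 0.
have -> : X = \sum_(t : 'I_3 * 'I_3 * 'I_3)
    coef t *: (dual_idem C e w t.1.1 *m adj_mx C e t.1.2 *m dual_idem C e w t.2).
  apply/matrixP => a b; rewrite summxE.
  set x := enum_val a; set y := enum_val b.
  rewrite (bigD1 (cls x y)) //= big1 ?addr0 => [|t nt].
    rewrite T0_generatorE // !mxE !eqxx mulr1 /coef.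
    case: pickP => [[x' y'] /eqP/= [ix ixy iy]|/(_ (x, y))]; last by rewrite eqxx.
    have [g [eg gw <- <-]] := st _ _ _ _ _ (esym ix) (esym iy) (esym ixy).
    by have /vertex_perm_commP -> := XC g eg gw; rewrite !enum_valK.
  rewrite T0_generatorE // !mxE -/x -/y; case: and3P => [[/eqP i1 /eqP i2 /eqP i3]|].
    by case/negP: nt; rewrite /cls i1 i2 i3; case: (t) => [[]].
  by rewrite mulr0.
apply: memv_suml => t _; apply/memvZ/memv_span.
by apply/mapP; exists t; rewrite ?mem_enum.
Qed.

End Matrices.

Theorem triply_transitive_of_stabilizer (R : realType) (T : finType) (e : rel T) :
  simple_graph e -> vertex_transitive e -> stabilizer_transitive e ->
  triply_transitive R e.
Proof.
move=> se vt st; have eI := se.2; split=> //.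
  exact: strongly_regular_of_transitive.
move=> w; have T0T := @T0_sub_terwilliger R[i] T e w.
have TC := @terwilliger_sub_centralizer R[i] T e w _ eI.
have CT0 := @centralizer_sub_T0 R[i] T e w _ eI st.
by split; apply/seteqP; split=> X /= XP; auto.
Qed.

(** * Quadratic forms over the field with two elements *)

Lemma F2_case (b : 'F_2) : b = 0 \/ b = 1.
Proof.
by case: b => [[|[|k]] ltk] //; [left|right]; apply: val_inj.
Qed.

Lemma F2_addbb (b : 'F_2) : b + b = 0.
Proof. by case: (F2_case b) => ->; apply: val_inj. Qed.

Lemma F2_eq0_inj (b c : 'F_2) : (b == 0) = (c == 0) -> b = c.
Proof. by case: (F2_case b) => ->; case: (F2_case c) => ->. Qed.

(** Identities in F_2 between expressions in variables, by evaluation at all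
    values of the variables. *)
Ltac F2_decide :=
  repeat match goal with |- context [?b] =>
    is_var b; case: (F2_case b) => -> end; exact: val_inj.

Lemma rV2_addvv n (v : 'rV['F_2]_n) : v + v = 0.
Proof. by apply/rowP => i; rewrite !mxE F2_addbb. Qed.

Lemma rV2_addKv n (u v : 'rV['F_2]_n) : u + (u + v) = v.
Proof. by rewrite addrA rV2_addvv add0r. Qed.

Lemma rV2_opp n (v : 'rV['F_2]_n) : - v = v.
Proof. by rewrite -[RHS]addr0 -[X in _ + X](subrr v) addrA rV2_addvv sub0r. Qed.

Lemma rV2_eqD n (u v w : 'rV['F_2]_n) : (u == v + w) = (u + v == w).
Proof. by rewrite addrC -subr_eq rV2_opp. Qed.

Lemma rV2_addeq0 n (u v : 'rV['F_2]_n) : (u + v == 0) = (u == v).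
Proof. by rewrite -[v in RHS]addr0 rV2_eqD. Qed.

Lemma separating_functional n k (y : 'rV['F_2]_n) (A : 'M['F_2]_(k, n)) :
  ~~ (y <= A)%MS -> exists f : 'cV['F_2]_n, A *m f = 0 /\ (y *m f) 0 0 = 1.
Proof.
rewrite submxE => /matrix0Pn[i [j yj]]; exists (col j (cokermx A)).
rewrite colE !(mulmxA _ (cokermx A)) mulmx_coker mul0mx -colE mxE; split=> //.
by rewrite (ord1 i) in yj; case: (F2_case ((y *m cokermx A) 0 j)) yj => ->.
Qed.

Definition polarization (V : zmodType) (Q : V -> 'F_2) (u v : V) : 'F_2 :=
  Q (u + v) + Q u + Q v.

(** Additivity of the polarization suffices for bilinearity, the scalars being
    0 and 1, and it forces Q 0 = 0. Nondegeneracy is stated as the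
    representability of every linear functional, the form in which it serves
    to choose vectors with prescribed products. *)
Definition nondegenerate_quadratic n (Q : 'rV['F_2]_n -> 'F_2) : Prop :=
  (forall u v w,
     polarization Q (u + v) w = polarization Q u w + polarization Q v w)
  /\ forall f : 'cV['F_2]_n, exists c, forall u, polarization Q u c = (u *m f) 0 0.

Definition isometry (V : zmodType) (Q : V -> 'F_2) (g : V -> V) : Prop :=
  {morph g : u v / u + v} /\ forall v, Q (g v) = Q v.

Section Witt.
Variables (n : nat) (Q : 'rV['F_2]_n -> 'F_2).
Hypothesis nQ : nondegenerate_quadratic Q.
Local Notation B := (polarization Q).
Implicit Types a c u v w x y : 'rV['F_2]_n.

Lemma polarC u v : B u v = B v u.
Proof. by rewrite /polarization [v + u]addrC addrAC. Qed.

Lemma polarDl u v w : B (u + v) w = B u w + B v w.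
Proof. exact: nQ.1. Qed.

Lemma polarDr u v w : B u (v + w) = B u v + B u w.
Proof. by rewrite ![B u _]polarC polarDl. Qed.

Lemma polar0l u : B 0 u = 0.
Proof. by apply: (@addrI _ (B 0 u)); rewrite -polarDl !addr0. Qed.

Lemma quadratic0 : Q 0 = 0.
Proof.
by have := polar0l 0; rewrite /polarization addr0 F2_addbb add0r.
Qed.

Lemma polarvv v : B v v = 0.
Proof. by rewrite /polarization rV2_addvv quadratic0 add0r F2_addbb. Qed.

Lemma quadraticD u v : Q (u + v) = Q u + Q v + B u v.
Proof. by rewrite /polarization; move: (Q _) (Q _) (Q _) => p q r; F2_decide. Qed.

Lemma quadraticZ (b : 'F_2) v : Q (b *: v) = b * Q v.
Proof.
by case: (F2_case b) => ->; rewrite ?scale0r ?scale1r ?quadratic0 ?mul0r ?mul1r.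
Qed.

Lemma polarZr (b : 'F_2) u v : B u (b *: v) = b * B u v.
Proof.
by case: (F2_case b) => ->; rewrite ?scale0r ?scale1r ?mul0r ?mul1r // polarC polar0l.
Qed.

(** The orthogonal reflection in a when Q a = 1. *)
Definition transvection a v := v + B v a *: a.

Lemma transvection_isometry a : Q a = 1 -> isometry Q (transvection a).
Proof.
move=> Qa; split=> [u v|v]; rewrite /transvection.
  by rewrite polarDl scalerDl addrACA.
rewrite quadraticD quadraticZ polarZr Qa.
by move: (Q v) (B v a) => p q; F2_decide.
Qed.

(** The Siegel transformation (Eichler transvection) attached to a singular
    vector a and a vector c orthogonal to a. On the orthogonal of a it is
    v |-> v + B v c *: a; the other terms extend this to an isometry of the
    whole space. *)
Definition siegel a c v := v + (B v a *: c + (B v c + Q c * B v a) *: a).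

Lemma siegel_isometry a c : Q a = 0 -> B a c = 0 -> isometry Q (siegel a c).
Proof.
move=> Qa Bac; split=> [u v|v]; rewrite /siegel.
  rewrite !polarDl [RHS]addrACA; congr (_ + _).
  by rewrite [RHS]addrACA -!scalerDl mulrDr [X in X *: a]addrACA.
rewrite !quadraticD !polarDr !quadraticZ !polarZr Qa [B (_ *: c) a]polarC polarZr Bac.
by move: (Q v) (Q c) (B v a) (B v c) => p q r s; F2_decide.
Qed.

Lemma isometry_id : isometry Q id. Proof. by []. Qed.

Lemma isometry_comp g h : isometry Q g -> isometry Q h -> isometry Q (g \o h).
Proof.
move=> [gD gQ] [hD hQ]; split=> [u v|v] /=; first by rewrite hD gD.
by rewrite gQ hQ.
Qed.

Lemma isometry0 g : isometry Q g -> g 0 = 0.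
Proof. by move=> [gD _]; apply: (@addrI _ (g 0)); rewrite -gD !addr0. Qed.

Lemma polar_isometry g u v : isometry Q g -> B (g u) (g v) = B u v.
Proof. by move=> [gD gQ]; rewrite /polarization -gD !gQ. Qed.

Lemma exists_separating_polar k v (A : 'M_(k, n)) : ~~ (v <= A)%MS ->
  exists c, B v c = 1 /\ forall i, B (row i A) c = 0.
Proof.
case/separating_functional=> f [Af vf]; have [c Bc] := nQ.2 f.
by exists c; rewrite Bc; split=> // i; rewrite Bc -row_mul Af !mxE.
Qed.

(** A vector in the kernel of g has product 0 with every vector. *)
Lemma isometry_inj g : isometry Q g -> injective g.
Proof.
move=> ig u v guv; apply/eqP; rewrite -[v]addr0 rV2_eqD; apply/negP=> /negP nuv.
have [|c [Bc _]] := @exists_separating_polar n (u + v) 0; first by rewrite submx0.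
have := polar_isometry (u + v) c ig; rewrite Bc ig.1 guv rV2_addvv polar0l.
by move/eqP; rewrite eq_sym oner_eq0.
Qed.

(** The extension step of the theorem of Witt, with x = 0 allowed. The vector
    a = y + y' is orthogonal to x and B y a = Q a, so the transvection along a
    settles the case Q a = 1. If Q a = 0, everything takes place in the
    orthogonal of a, where a Siegel transformation adds B v c *: a to v: one
    needs c orthogonal to a and x with B y c = 1. Such a c exists unless y is
    one of 0, x, a and a + x, and the last two mean y' = 0 and y' = x. *)
Lemma isometry_extension x y y' :
  y != 0 -> y != x -> y' != 0 -> y' != x -> Q y = Q y' -> B x y = B x y' ->
  exists g, [/\ isometry Q g, g x = x & g y = y'].
Proof.
move=> y0 yx y'0 y'x Qy Bxy; pose a := y + y'.
have ya : y + a = y' by rewrite rV2_addKv.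
have Bxa : B x a = 0 by rewrite polarDr Bxy F2_addbb.
have Qa : Q a = B y y' by rewrite quadraticD Qy F2_addbb add0r.
have Bya : B y a = Q a by rewrite polarDr polarvv add0r Qa.
case: (F2_case (Q a)) => Q_a; rewrite Q_a in Bya; last first.
  exists (transvection a); split; first exact: transvection_isometry.
  - by rewrite /transvection Bxa scale0r addr0.
  - by rewrite /transvection Bya scale1r.
have [|c [Byc Bc]] := @exists_separating_polar _ y (col_mx a x).
  apply/negP; rewrite -addsmxE => /sub_addsmxP[[s t]] /=.
  rewrite (mx11_scalar s) (mx11_scalar t) !mul_scalar_mx.
  (* the four elements 0, x, a and a + x of the span of a and x *)
  case: (F2_case (s 0 0)) => ->; case: (F2_case (t 0 0)) => ->;
    rewrite ?scale0r ?scale1r ?addr0 ?add0r => /eqP.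
  - by rewrite (negPf y0).
  - by rewrite (negPf yx).
  - by rewrite rV2_eqD rV2_addvv eq_sym (negPf y'0).
  - by rewrite rV2_eqD ya (negPf y'x).
have Bac : B a c = 0 by rewrite -(Bc (lshift 1 0)) rowKu row_id.
have Bxc : B x c = 0 by rewrite -(Bc (rshift 1 0)) rowKd row_id.
exists (siegel a c); split; first exact: siegel_isometry.
- by rewrite /siegel Bxa Bxc mulr0 addr0 !scale0r !addr0.
- by rewrite /siegel Bya Byc mulr0 scale0r add0r addr0 scale1r.
Qed.

(** The theorem of Witt for two vectors. Over F_2 two distinct nonzero vectors
    are independent, so equality and vanishing are the only linear relations
    that have to be matched. *)
Lemma isometry_pair x y x' y' :
  (x == 0) = (x' == 0) -> (y == 0) = (y' == 0) -> (x == y) = (x' == y') ->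
  Q x = Q x' -> Q y = Q y' -> Q (x + y) = Q (x' + y') ->
  exists g, [/\ isometry Q g, g x = x' & g y = y'].
Proof.
move=> ex0 ey0 exy Qx Qy Qxy.
have [g [ig gx]] : exists g, isometry Q g /\ g x = x'.
  have [x0|x0] := eqVneq x 0.
    by exists id; move: ex0; rewrite x0 eqxx => /esym/eqP->.
  have x'0 : x' != 0 by rewrite -ex0.
  have [//|g [ig _ gx]] := @isometry_extension 0 x x' x0 x0 x'0 x'0 Qx.
    by rewrite !polar0l.
  by exists g.
have [y0|y0] := eqVneq y 0.
  exists g; split=> //; move: ey0; rewrite y0 eqxx => /esym/eqP->.
  exact: isometry0.
have [xy|xy] := eqVneq x y.
  by exists g; split=> //; move: exy; rewrite -xy eqxx gx => /esym/eqP.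
have gI := isometry_inj ig.
have [|||||| h [ih hx hy]] := @isometry_extension x' (g y) y'.
- by rewrite -(isometry0 ig) (inj_eq gI).
- by rewrite -gx (inj_eq gI) eq_sym.
- by rewrite -ey0.
- by rewrite eq_sym -exy.
- by rewrite ig.2.
- by rewrite -gx polar_isometry // /polarization Qxy Qx Qy gx.
by exists (h \o g); rewrite /= gx; split=> //; apply: isometry_comp.
Qed.

Definition affine_polar_graph : rel 'rV['F_2]_n :=
  fun u v => (u != v) && (Q (u - v) == 0).

Lemma affine_polar_simple : simple_graph affine_polar_graph.
Proof.
split=> [u v|u]; rewrite /affine_polar_graph ?eqxx //.
by rewrite eq_sym !rV2_opp addrC.
Qed.

(** The affine maps are written with u0 added before g and v0 after it so
    that one formula covers the translations (g = id) and the conjugates of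
    isometries by translations, which fix u0 when v0 = u0. *)
Lemma affine_isometry_automorphism g u0 v0 : isometry Q g ->
  exists2 p : {perm 'rV['F_2]_n}, is_automorphism affine_polar_graph p
    & forall v, p v = g (v + u0) + v0.
Proof.
move=> ig; have fI : injective (fun v => g (v + u0) + v0).
  by move=> u v /addIr/(isometry_inj ig)/addIr.
exists (perm fI) => [u v|v]; last by rewrite permE.
rewrite /affine_polar_graph (inj_eq perm_inj) !permE !rV2_opp addrACA rV2_addvv addr0 -ig.1 ig.2.
by rewrite addrACA rV2_addvv addr0.
Qed.

Lemma affine_polar_vertex_transitive : vertex_transitive affine_polar_graph.
Proof.
move=> x y; have [p ep pE] := affine_isometry_automorphism x y isometry_id.
by exists p; rewrite ?pE ?rV2_addvv ?add0r.
Qed.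

Lemma affine_polar_rel_index u v u' v' :
  rel_index affine_polar_graph u v = rel_index affine_polar_graph u' v' ->
  (u + v == 0) = (u' + v' == 0) /\ Q (u + v) = Q (u' + v').
Proof.
case/(rel_index_inj affine_polar_simple.2).
rewrite /affine_polar_graph -(rV2_addeq0 u v) -(rV2_addeq0 u' v') !rV2_opp => e0 e1.
split=> //; move: e0 e1.
by case: eqP => [->|_]; case: eqP => [->|_] //= _; apply: F2_eq0_inj.
Qed.

Lemma affine_polar_stabilizer_transitive :
  stabilizer_transitive affine_polar_graph.
Proof.
move=> w x y x' y' /affine_polar_rel_index[x0 Qx] /affine_polar_rel_index[y0 Qy].
case/affine_polar_rel_index=> xy Qxy.
have wD u v : (w + u) + (w + v) = u + v by rewrite addrACA rV2_addvv add0r.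
have [||g [ig gx gy]] := isometry_pair x0 y0 _ Qx Qy.
- by rewrite -[LHS]rV2_addeq0 -[RHS]rV2_addeq0 !wD.
- by rewrite !wD.
have [p ep pE] := affine_isometry_automorphism w w ig.
exists p; split; rewrite // pE.
- by rewrite rV2_addvv isometry0 ?add0r.
- by rewrite addrC [x + w]addrC gx rV2_addKv.
- by rewrite addrC [y + w]addrC gy rV2_addKv.
Qed.

Theorem affine_polar_triply_transitive (R : realType) :
  triply_transitive R affine_polar_graph.
Proof.
apply: triply_transitive_of_stabilizer; first exact: affine_polar_simple.
  exact: affine_polar_vertex_transitive.
exact: affine_polar_stabilizer_transitive.
Qed.

End Witt.

(** * The standard forms *)

Lemma entryE n (x : 'rV['F_2]_n) (i : 'I_n) : entry x i = x 0 i.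
Proof. by rewrite /entry valK. Qed.

Lemma entryD n (u v : 'rV['F_2]_n) k : entry (u + v) k = entry u k + entry v k.
Proof. by rewrite /entry; case: insub => [i|]; rewrite ?mxE ?addr0. Qed.

Lemma sum_pairs m (F : nat -> 'F_2) :
  \sum_(k < 2 * m) F k = \sum_(i < m) (F (2 * i)%N + F (2 * i).+1).
Proof.
elim: m => [|m IHm]; first by rewrite muln0 !big_ord0.
by rewrite mulnS !big_ord_recr /= IHm addrA.
Qed.

Lemma polar_tailD (eps : int) (s t s' t' : 'F_2) :
  polar_tail eps (s + s') (t + t') =
  polar_tail eps s t + polar_tail eps s' t' + (s * t' + t * s').
Proof. by rewrite /polar_tail; case: ifP => _; F2_decide. Qed.

(** Both tails have the polarization of a hyperbolic plane, so eps does not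
    enter. *)
Lemma polar_form_polarization m (eps : int) (u v : 'rV['F_2]_(2 * m)) : (0 < m)%N ->
  polarization (@polar_form m eps) u v =
  \sum_(i < m) (entry u (2 * i) * entry v (2 * i).+1
                + entry u (2 * i).+1 * entry v (2 * i)).
Proof.
case: m u v => // m u v _; rewrite big_ord_recr /= /polarization /polar_form /=.
rewrite !entryD polar_tailD.
have -> : \sum_(i < m) entry (u + v) (2 * i) * entry (u + v) (2 * i).+1 =
    \sum_(i < m) entry u (2 * i) * entry u (2 * i).+1
    + \sum_(i < m) entry v (2 * i) * entry v (2 * i).+1
    + \sum_(i < m) (entry u (2 * i) * entry v (2 * i).+1
                + entry u (2 * i).+1 * entry v (2 * i)).
  rewrite -!big_split /=; apply: eq_bigr => i _; rewrite !entryD.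
  move: (entry u _) (entry u _) (entry v _) (entry v _) => p q r s.
  by F2_decide.
move: (\sum_(i < m) _) (\sum_(i < m) _) (\sum_(i < m) _) => b1 b2 b3.
move: (polar_tail _ _ _) (polar_tail _ _ _) (_ * _ + _) => p q r.
by F2_decide.
Qed.

Lemma polar_form_nondegenerate m (eps : int) : (0 < m)%N ->
  nondegenerate_quadratic (@polar_form m eps).
Proof.
move=> m0; split=> [u v w|f].
  rewrite !polar_form_polarization // -big_split; apply: eq_bigr => i _ /=.
  by rewrite !entryD !mulrDl addrACA.
(* The Gram matrix exchanges the two coordinates of each pair, so the vector
   representing f is f with these coordinates exchanged. *)
pose swap k := if odd k then k.-1 else k.+1.
exists (\row_k entry f^T (swap k)) => u; rewrite polar_form_polarization //.
have -> : (u *m f) 0 0 = \sum_(k < 2 * m) entry u k * entry f^T k.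
  by rewrite mxE; apply: eq_bigr => k _; rewrite !entryE mxE.
rewrite (sum_pairs m (fun k => entry u k * entry f^T k)).
apply: eq_bigr => i _.
have lt1 : (2 * i < 2 * m)%N by rewrite ltn_mul2l ltn_ord.
have lt2 : ((2 * i).+1 < 2 * m)%N.
  by have := leq_mul (leqnn 2) (ltn_ord i); rewrite mulnS.
have := entryE (\row_k entry f^T (swap k)) (Ordinal lt1).
have := entryE (\row_k entry f^T (swap k)) (Ordinal lt2).
rewrite !mxE /= /swap /= oddM /= => -> ->.
by rewrite addrC.
Qed.

Theorem theorem3p6 :
  forall (R : realType) (m : nat) (eps : int),
    (2 <= m)%N -> eps = 1 \/ eps = -1 -> triply_transitive R (@VO m eps).
Proof.
move=> R m eps m2 _; apply: (affine_polar_triply_transitive _).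
by apply: polar_form_nondegenerate; apply: leq_trans m2.
Qed.
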